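(* Let $k\ge1$ be an integer with $k\le\frac{N-1}{2}$. Then: (1) There is a $K$-equivariant isomorphism $\mathrm{Hess}_k^{O,\perp}|_{\mathfrak g_1^{rs}}\simeq X_{2k-1}$ of varieties over $\mathfrak g_1^{rs}$. (2) There is a $K$-equivariant isomorphism $\mathrm{Hess}_k^{E,\perp}|_{\mathfrak g_1^{rs}}\simeq X_{2k}$ of varieties over $\mathfrak g_1^{rs}$.
   Context: $V=\mathbb C^N$ with a non-degenerate quadratic form $Q$ and associated symmetric bilinear form $\langle\,,\rangle_Q$; $K=SO(V,Q)$; $\mathfrak g_1=\{x\in\mathfrak{sl}(V):\langle xu,v\rangle_Q=\langle u,xv\rangle_Q\ \forall u,v\}$, on which $K$ acts by conjugation; $\mathfrak g_1^{rs}\subset\mathfrak g_1$ is the open set of regular semisimple elements, i.e. diagonalizable $x\in\mathfrak g_1$ with $N$ distinct eigenvalues. For a subspace $U$, $U^\perp$ is its orthogonal complement for $\langle\,,\rangle_Q$. $\mathrm{Hess}_k^{O,\perp}$ is the variety of triples $(x,V_{k-1}\subset V_k)$ where $x\in\mathfrak g_1$, $V_{k-1}\subset V_k\subset V$ are isotropic subspaces with $\dim V_i=i$, and $xV_{k-1}\subset V_k$. $\mathrm{Hess}_k^{E,\perp}\subset\mathrm{Hess}_k^{O,\perp}$ is the subvariety where moreover $xV_k\subset V_k^\perp$. (Both are vector bundles over the partial flag variety of $K$ parametrizing flags $V_{k-1}\subset V_k$.) Both map to $\mathfrak g_1$ by $(x,V_{k-1}\subset V_k)\mapsto x$. For $1\le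 m\le N-1$, $X_m\to\mathfrak g_1^{rs}$ is the family whose fiber over $s$ is the complete intersection of $m$ quadrics $X_{m,s}=\{[v]\in\mathbb P(V):\langle s^iv,v\rangle_Q=0,\ i=0,\dots,m-1\}$. $K$ acts naturally on all these varieties. *)

(* Defs.v *)
From HB Require Import structures.
From mathcomp Require Import all_boot all_order all_algebra.
From mathcomp Require Import classical_sets.
From mathcomp Require Import mpoly ring.

Set Implicit Arguments.
Unset Strict Implicit.
Unset Printing Implicit Defensive.

Import Order.TTheory GRing.Theory Num.Theory.
Local Open Scope ring_scope.

(* A (reduced, classical) variety is handled through its set of closed points,
   its Zariski topology and its regular functions.  [fs_regular U f] says that
   [f] is regular on the open set [U]; the values of [f] outside [U] are
   irrelevant. *)
Record function_space (F : fieldType) := FunctionSpace {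
  fs_point :> Type;
  fs_open : set (set fs_point);
  fs_regular : set fs_point -> set (fs_point -> F) }.

Definition fs_morphism (F : fieldType) (X Y : function_space F) (f : X -> Y) :=
  (forall U, fs_open U -> fs_open (f @^-1` U)%classic) /\
  (forall U h, fs_open U -> fs_regular U h ->
     fs_regular (f @^-1` U)%classic (fun x => h (f x))).

Definition fs_isomorphism (F : fieldType) (X Y : function_space F)
    (f : X -> Y) :=
  fs_morphism f /\
  exists2 g : Y -> X, cancel f g /\ cancel g f & fs_morphism g.

Definition polynomial_function (F : fieldType) (E : vectType F) (f : E -> F) :=
  exists p : {mpoly F[\dim {:E}]},
    forall e, f e = p.@[fun i => coord (vbasis {:E}) i e].

(* The structure induced on [Z] by homogeneous coordinates: [rep e z] means
   that the vector [e] of the affine space [E] is a coordinate system for the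
   point [z].  A subset of [Z] is open when its preimage is a union of traces
   of principal open sets, and a function on an open set is regular when, on
   the coordinates, it is locally a quotient of polynomials.
   It is used for subsets of products of an affine space with Grassmannians,
   a subspace of dimension d of F^N having as coordinates the N x d matrices
   whose columns form one of its bases (so Gr(d, N) carries its usual
   structure of quotient, by GL_d, of the open set of matrices of rank d,
   and this is the usual P^(N-1) for d = 1). *)
Definition coordinate_space (F : fieldType) (E : vectType F) (Z : Type)
    (rep : E -> Z -> Prop) : function_space F :=
  @FunctionSpace F Z
    (fun U => forall e z, rep e z -> U z ->
       exists b : E -> F, [/\ polynomial_function b, b e != 0 &
         forall e' z', rep e' z' -> b e' != 0 -> U z'])
    (fun U f => forall e z, rep e z -> U z ->
       exists a b : E -> F,
         [/\ polynomial_function a, polynomial_function b, b e != 0 &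
           forall e' z', rep e' z' -> U z' -> b e' != 0 ->
             f z' = a e' / b e']).

Definition mximg (F : fieldType) (m n : nat) (A : 'M[F]_(m, n))
    (V : {vspace 'cV[F]_n}) : {vspace 'cV[F]_m} :=
  (linfun (mulmx A : 'cV[F]_n -> 'cV[F]_m) @: V)%VS.

Definition colspan (F : fieldType) (m n : nat) (A : 'M[F]_(m, n)) :=
  mximg A fullv.

Section HessenbergAndQuadrics.
Variables (F : numClosedFieldType) (N : nat) (B : {symmetric 'cV[F]_N}).
Local Open Scope classical_set_scope.

(* The quadratic form is given through its associated symmetric bilinear form
   [B], which determines it (and conversely) in characteristic 0. *)
Definition quadratic_form (v : 'cV[F]_N) : F := B v v.

Definition SO : set 'M[F]_N :=
  [set g | \det g = 1 /\
           forall v, quadratic_form (g *m v) = quadratic_form v].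

Definition g1 : set 'M[F]_N :=
  [set x | \tr x = 0 /\ forall u v, B (x *m u) v = B u (x *m v)].

Definition distinct_eigenvalues (x : 'M[F]_N) :=
  exists s : seq F, [/\ uniq s, size s = N & all (eigenvalue x) s].

Definition g1rs : set 'M[F]_N :=
  [set x | [/\ g1 x, diagonalizable x & distinct_eigenvalues x]].

Definition isotropic (V : {vspace 'cV[F]_N}) := (V <= orthov B V)%VS.

(* A point (x, V_{k-1}, V_k) is encoded as ((x, V_{k-1}), V_k). *)
Definition HessO (k : nat) :
    set ('M[F]_N * {vspace 'cV[F]_N} * {vspace 'cV[F]_N}) :=
  [set h | let: (x, V', V) := h in
    [/\ g1 x, isotropic V' /\ isotropic V, \dim V' = k.-1 /\ \dim V = k,
        (V' <= V)%VS & (mximg x V' <= V)%VS]].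

Definition HessE (k : nat) :
    set ('M[F]_N * {vspace 'cV[F]_N} * {vspace 'cV[F]_N}) :=
  [set h | HessO k h /\
    let: (x, V', V) := h in (mximg x V <= orthov B V)%VS].

Definition over_rs (Z : set ('M[F]_N * {vspace 'cV[F]_N} * {vspace 'cV[F]_N})) :=
  [set h | Z h /\ g1rs h.1.1].

(* A point of P(V) is a line of V. *)
Definition quadrics (m : nat) : set ('M[F]_N * {vspace 'cV[F]_N}) :=
  [set p | [/\ g1rs p.1, \dim p.2 = 1%N & forall v, v \in p.2 ->
    forall i : 'I_m, B (p.1 ^+ i *m v) v = 0]].


Definition conj_act (g x : 'M[F]_N) := g *m x *m invmx g.

Definition flag_act (g : 'M[F]_N)
    (h : 'M[F]_N * {vspace 'cV[F]_N} * {vspace 'cV[F]_N}) :=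
  (conj_act g h.1.1, mximg g h.1.2, mximg g h.2).

Definition line_act (g : 'M[F]_N) (p : 'M[F]_N * {vspace 'cV[F]_N}) :=
  (conj_act g p.1, mximg g p.2).

Lemma SO_unit g : SO g -> g \in unitmx.
Proof. by case=> dg _; rewrite unitmxE dg unitr1. Qed.

Lemma SO_form g u v : SO g -> B (g *m u) (g *m v) = B u v.
Proof.
case=> _ Qg; have sym w z : B w z = B z w by rewrite hermC expr0 mul1r.
have pol w z : B w z *+ 2 =
    quadratic_form (w + z) - quadratic_form w - quadratic_form z.
  rewrite /quadratic_form linearDl !linearDr /= (sym z w).
  by ring.
have /eqP := pol u v; rewrite -Qg -(Qg u) -(Qg v) mulmxDr -pol.
by rewrite eq_sym eqrMn2r // => /eqP.
Qed.

Lemma SO_surj g (v : 'cV[F]_N) : SO g -> v = g *m (invmx g *m v).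
Proof. by move=> /SO_unit gu; rewrite mulmxA mulmxV // mul1mx. Qed.

Lemma mximgM (g x : 'M[F]_N) V : mximg (g *m x) V = mximg g (mximg x V).
Proof.
rewrite /mximg -limg_comp; congr (_ @: _)%VS; apply/lfunP => v.
by rewrite comp_lfunE !lfunE /= mulmxA.
Qed.

Lemma mem_mximg (g : 'M[F]_N) (V : {vspace 'cV[F]_N}) u :
  u \in mximg g V -> exists2 v, v \in V & u = g *m v.
Proof. by move/memv_imgP => [v Vv ->]; exists v => //; rewrite lfunE. Qed.

Lemma mximg_conj g x V : SO g ->
  mximg (conj_act g x) (mximg g V) = mximg g (mximg x V).
Proof.
move=> /SO_unit gu; rewrite -!mximgM /conj_act.
by rewrite -!mulmxA mulVmx // mulmx1.
Qed.

Lemma dim_mximg g V : SO g -> \dim (mximg g V) = \dim V.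
Proof.
move=> /SO_unit gu; apply: limg_dim_eq; apply/eqP.
rewrite -subv0 (subv_trans (capvSr _ _)) //; apply/subvP => v.
rewrite memv_ker lfunE /= memv0 => /eqP gv0.
by rewrite -[v]mul1mx -(mulVmx gu) -mulmxA gv0 mulmx0.
Qed.

Lemma mximgS (g : 'M[F]_N) (V W : {vspace 'cV[F]_N}) :
  (V <= W)%VS -> (mximg g V <= mximg g W)%VS.
Proof. exact: limgS. Qed.

Lemma orthov_mximg g V W : SO g ->
  (V <= orthov B W)%VS -> (mximg g V <= orthov B (mximg g W))%VS.
Proof.
move=> Kg /orthovP VW; apply/orthovP => _ _ /mem_mximg[u Vu ->] /mem_mximg[v Wv ->].
by rewrite SO_form // VW.
Qed.

Lemma g1_conj g x : SO g -> g1 x -> g1 (conj_act g x).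
Proof.
move=> Kg [tx Bx]; have gu := SO_unit Kg; split.
  by rewrite /conj_act mxtrace_mulC mulmxA mulVmx // mul1mx.
move=> u v; rewrite {1}(SO_surj v Kg) {2}(SO_surj u Kg) /conj_act.
by rewrite -!mulmxA !SO_form // Bx.
Qed.

Lemma g1rs_conj g x : SO g -> g1rs x -> g1rs (conj_act g x).
Proof.
move=> Kg [gx [P Pu dx] [s [us ss es]]]; have gu := SO_unit Kg.
split; first exact: g1_conj.
  exists (P *m invmx g); first by rewrite unitmx_mul Pu unitmx_inv.
  case/diagonalizable_forPex: dx => D /(simmxP Pu) PxD.
  apply/diagonalizable_forPex; exists D; apply/simmxP.
    by rewrite unitmx_mul Pu unitmx_inv.
  by rewrite /conj_act !mulmxA mulmxKV // PxD.
exists s; split=> //; apply/allP => a /(allP es) /eigenvalueP[v vx v0].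
apply/eigenvalueP; exists (v *m invmx g).
  by rewrite /conj_act !mulmxA mulmxKV // vx -scalemxAl.
apply: contra_neq v0 => v0.
by rewrite -[v](mulmxKV gu) v0 mul0mx.
Qed.

Lemma HessO_stable k g h : SO g -> over_rs (HessO k) h ->
  over_rs (HessO k) (flag_act g h).
Proof.
case: h => [[x V'] V] Kg [[gx [iV' iV] [dV' dV] sV xV] rx].
split; last exact: g1rs_conj.
split; rewrite /= ?dim_mximg ?mximg_conj //; do ?exact: mximgS.
- exact: g1_conj.
- by split; exact: orthov_mximg.
Qed.

Lemma HessE_stable k g h : SO g -> over_rs (HessE k) h ->
  over_rs (HessE k) (flag_act g h).
Proof.
case: h => [[x V'] V] Kg [[Hh xV] rx].
have [Hgh ?] := @HessO_stable k g (x, V', V) Kg (conj Hh rx).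
do 2?split=> //=.
by rewrite mximg_conj //; exact: orthov_mximg.
Qed.

Lemma conj_act_exp g x i (v : 'cV[F]_N) : SO g ->
  conj_act g x ^+ i *m (g *m v) = g *m (x ^+ i *m v).
Proof.
move=> /SO_unit gu; elim: i => [|i IHi]; first by rewrite !expr0 !mul1mx.
rewrite !exprS -!mulmxE -mulmxA IHi /conj_act -!mulmxA.
by rewrite [invmx g *m _]mulmxA mulVmx // mul1mx.
Qed.

Lemma quadrics_stable m g p : SO g -> quadrics m p ->
  quadrics m (line_act g p).
Proof.
case: p => [x L] Kg [rx dL qL]; split; first exact: g1rs_conj.
  by rewrite /= dim_mximg.
move=> _ /mem_mximg[v Lv ->] i /=.
by rewrite conj_act_exp // SO_form // qL.
Qed.

Definition restricted_act (T : Type) (a : 'M[F]_N -> T -> T) (Z : set T)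
    (aZ : forall g z, SO g -> Z z -> Z (a g z)) (g : SO) (z : Z) : Z :=
  SigSub (mem_set (aZ _ _ (set_valP g) (set_valP z))).

(* In [flag_space] and [line_space] the matrices have full rank, because the
   sets [Z] they are used for prescribe the dimensions of the subspaces. *)
Definition flag_space (k : nat)
    (Z : set ('M[F]_N * {vspace 'cV[F]_N} * {vspace 'cV[F]_N})) :=
  @coordinate_space F
    ('M[F]_N * 'M[F]_(N, k.-1) * 'M[F]_(N, k))%type Z
    (fun e z => val z = (e.1.1, colspan e.1.2, colspan e.2)).

Definition line_space (Z : set ('M[F]_N * {vspace 'cV[F]_N})) :=
  @coordinate_space F ('M[F]_N * 'cV[F]_N)%type Z
    (fun e z => val z = (e.1, <[e.2]>%VS)).

Definition equivariant_isomorphism_over_g1rs (k m : nat)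
    (Z : set ('M[F]_N * {vspace 'cV[F]_N} * {vspace 'cV[F]_N}))
    (actZ : SO -> Z -> Z) (phi : Z -> quadrics m) :=
  [/\ @fs_isomorphism F (flag_space k Z) (line_space (quadrics m)) phi,
      forall h : Z, (val (phi h)).1 = (val h).1.1 &
      forall (g : SO) (h : Z),
        phi (actZ g h) = restricted_act (@quadrics_stable m) g (phi h)].

End HessenbergAndQuadrics.

(* Main.v *)
From HB Require Import structures.
Require Import Defs.
From mathcomp Require Import all_boot all_order all_algebra.
From mathcomp Require Import classical_sets reals complex mpoly zify.

Set Implicit Arguments.
Unset Strict Implicit.
Unset Printing Implicit Defensive.

Import Order.TTheory GRing.Theory Num.Theory.
Local Open Scope ring_scope.

(** A line spanned by v determines the flag spanned by its Krylov vectors,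
    V_{k-1} = <v, x v, ..., x^{k-2} v> inside V_k = <v, x v, ..., x^{k-1} v>.
    Since x is self-adjoint, <x^i v, x^j v> = <x^{i+j} v, v>, so the equations
    of X_{2k-1} at v say exactly that V_k is isotropic, and the additional
    equation of X_{2k} says that x V_k is orthogonal to V_k.

    Regular semisimplicity enters through one fact
    ([invariant_isotropic_eq0]): a nonzero x-invariant subspace contains an
    eigenvector, which is not isotropic, so no nonzero isotropic subspace is
    x-invariant.  Hence the Krylov vectors of v stay independent as long as
    they span an isotropic space ([dim_krylov]), and the line can be recovered
    from V_k as the space of all w with w, x w, ..., x^{k-1} w in V_k
    ([krylov_coreK]).  Conversely every Hessenberg flag arises in this way: an
    iterated dimension count gives a nonzero w of that kind
    ([ex_krylov_generator]), and then the flag must be the Krylov flag of w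
    ([HessO_generator]).  The two constructions are therefore inverse to each
    other, and both commute with the action of K because they are natural.

    Passing from lines to flags is visibly regular, as the Krylov vectors are
    polynomial in (x, v).  For the other direction let the columns of a matrix C
    be a basis of V_k.  The matrices X for which C X consists of the Krylov
    vectors of its own first column are the solutions of a linear system with
    coefficients polynomial in (x, C), and the solutions form a line
    ([krylov_system_kernel]).  Near a given point, a spanning vector of such a
    line of solutions is given by polynomial formulas
    ([polynomial_kernel_line]), and the first column of C X is the wanted v. *)

(** * Polynomial functions and maps *)

Section PolynomialFunctions.
Variables (F : fieldType) (E : vectType F).
Implicit Types (f g : E -> F).

Lemma polynomial_function_ext f g :
  f =1 g -> polynomial_function f -> polynomial_function g.
Proof. by move=> fg [p pE]; exists p => e; rewrite -fg. Qed.

Lemma polynomial_function_cst c : polynomial_function (fun _ : E => c).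
Proof. by exists c%:MP => e; rewrite mevalC. Qed.

Lemma polynomial_functionD f g : polynomial_function f ->
  polynomial_function g -> polynomial_function (fun e => f e + g e).
Proof. by move=> [p pE] [q qE]; exists (p + q) => e; rewrite mevalD pE qE. Qed.

Lemma polynomial_functionM f g : polynomial_function f ->
  polynomial_function g -> polynomial_function (fun e => f e * g e).
Proof. by move=> [p pE] [q qE]; exists (p * q) => e; rewrite mevalM pE qE. Qed.

Lemma polynomial_function_sum I (r : seq I) (P : pred I) (f : I -> E -> F) :
  (forall i, polynomial_function (f i)) ->
  polynomial_function (fun e => \sum_(i <- r | P i) f i e).
Proof.
move=> fP; elim: r => [|i r IH].
  apply: polynomial_function_ext (polynomial_function_cst 0) => e.
  by rewrite big_nil.
apply: (@polynomial_function_ext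
  (fun e => (if P i then f i e else 0) + \sum_(j <- r | P j) f j e)).
  by move=> e; rewrite big_cons; case: (P i); rewrite ?add0r.
apply: polynomial_functionD IH; case: (P i) => //.
exact: polynomial_function_cst.
Qed.

Lemma polynomial_function_prod I (r : seq I) (P : pred I) (f : I -> E -> F) :
  (forall i, polynomial_function (f i)) ->
  polynomial_function (fun e => \prod_(i <- r | P i) f i e).
Proof.
move=> fP; elim: r => [|i r IH].
  apply: polynomial_function_ext (polynomial_function_cst 1) => e.
  by rewrite big_nil.
apply: (@polynomial_function_ext
  (fun e => (if P i then f i e else 1) * \prod_(j <- r | P j) f j e)).
  by move=> e; rewrite big_cons; case: (P i); rewrite ?mul1r.
apply: polynomial_functionM IH; case: (P i) => //.
exact: polynomial_function_cst.
Qed.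

Lemma polynomial_function_coord i :
  polynomial_function (coord (vbasis {:E}) i : E -> F).
Proof. by exists 'X_i => e; rewrite mevalXU. Qed.

Lemma polynomial_function_linear (l : {linear E -> F | *%R}) :
  polynomial_function l.
Proof.
apply: (@polynomial_function_ext
  (fun e => \sum_i coord (vbasis {:E}) i e * l (vbasis {:E})`_i)).
  move=> e; rewrite [in RHS](coord_vbasis (memvf e)) linear_sum.
  by apply: eq_bigr => i _; rewrite linearZ.
apply: polynomial_function_sum => i; apply: polynomial_functionM.
  exact: polynomial_function_coord.
exact: polynomial_function_cst.
Qed.

(** Testing against all linear forms, and not only against the coordinates in
    the chosen basis, makes it possible to build maps into matrices or products
    from whichever basis is convenient there. *)
Definition polynomial_map (E' : vectType F) (phi : E -> E') :=
  forall l : {linear E' -> F | *%R}, polynomial_function (fun e => l (phi e)).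

Lemma polynomial_map_sum (E' : vectType F) (I : finType) (f : I -> E -> F)
    (v : I -> E') :
  (forall i, polynomial_function (f i)) ->
  polynomial_map (fun e => \sum_i f i e *: v i).
Proof.
move=> fP l; apply: (@polynomial_function_ext
  (fun e => \sum_i f i e * l (v i))).
  by move=> e; rewrite linear_sum; apply: eq_bigr => i _; rewrite linearZ.
apply: polynomial_function_sum => i; apply: polynomial_functionM => //.
exact: polynomial_function_cst.
Qed.

Lemma polynomial_function_comp (E' : vectType F) (phi : E -> E') (f : E' -> F) :
  polynomial_map phi -> polynomial_function f ->
  polynomial_function (fun e => f (phi e)).
Proof.
move=> phiP [p pE]; apply: (@polynomial_function_ext (fun e =>
  \sum_(m <- msupp p) p@_m *
    \prod_i \prod_(j < m i) coord (vbasis {:E'}) i (phi e))).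
  move=> e; rewrite pE mevalE; apply: eq_bigr => m _; congr (_ * _).
  by apply: eq_bigr => i _; rewrite prodr_const card_ord.
apply: polynomial_function_sum => m; apply: polynomial_functionM.
  exact: polynomial_function_cst.
do 2!apply: polynomial_function_prod => ?; exact: phiP.
Qed.

Definition polynomial_mx m n (M : E -> 'M[F]_(m, n)) :=
  forall i j, polynomial_function (fun e => M e i j).

Lemma polynomial_mx_cst m n (M : 'M[F]_(m, n)) : polynomial_mx (fun _ => M).
Proof. by move=> i j; apply: polynomial_function_cst. Qed.

Lemma polynomial_mxM m n p (M : E -> 'M[F]_(m, n)) (M' : E -> 'M[F]_(n, p)) :
  polynomial_mx M -> polynomial_mx M' -> polynomial_mx (fun e => M e *m M' e).
Proof.
move=> MP MP' i j; apply: (@polynomial_function_ext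
  (fun e => \sum_l M e i l * M' e l j)); first by move=> e; rewrite mxE.
by apply: polynomial_function_sum => l; apply: polynomial_functionM.
Qed.

Lemma polynomial_mxD m n (M M' : E -> 'M[F]_(m, n)) :
  polynomial_mx M -> polynomial_mx M' -> polynomial_mx (fun e => M e + M' e).
Proof.
move=> MP MP' i j; apply: (@polynomial_function_ext
  (fun e => M e i j + M' e i j)); first by move=> e; rewrite mxE.
exact: polynomial_functionD.
Qed.

Lemma polynomial_mxN m n (M : E -> 'M[F]_(m, n)) :
  polynomial_mx M -> polynomial_mx (fun e => - M e).
Proof.
move=> MP i j; apply: (@polynomial_function_ext
  (fun e => -1 * M e i j)); first by move=> e; rewrite mxE mulN1r.
by apply: polynomial_functionM => //; apply: polynomial_function_cst.
Qed.

Lemma polynomial_mxX n (M : E -> 'M[F]_n) i :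
  polynomial_mx M -> polynomial_mx (fun e => M e ^+ i).
Proof.
move=> MP; elim: i => [|i IH]; first exact: polynomial_mx_cst.
move=> a b; apply: (@polynomial_function_ext
  (fun e => (M e *m M e ^+ i) a b)); first by move=> e; rewrite exprS.
exact: polynomial_mxM.
Qed.

Lemma polynomial_det n (M : E -> 'M[F]_n) :
  polynomial_mx M -> polynomial_function (fun e => \det (M e)).
Proof.
move=> MP; apply: polynomial_function_sum => s; apply: polynomial_functionM.
  exact: polynomial_function_cst.
by apply: polynomial_function_prod => i; apply: MP.
Qed.

Lemma polynomial_adj n (M : E -> 'M[F]_n) :
  polynomial_mx M -> polynomial_mx (fun e => \adj (M e)).
Proof.
move=> MP i j; apply: (@polynomial_function_ext
  (fun e => cofactor (M e) j i)); first by move=> e; rewrite mxE.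
apply: polynomial_functionM; first exact: polynomial_function_cst.
apply: polynomial_det => a b.
apply: (@polynomial_function_ext (fun e => M e (lift j a) (lift i b))) => //.
by move=> e; rewrite !mxE.
Qed.

Lemma polynomial_map_mx m n (M : E -> 'M[F]_(m, n)) :
  polynomial_mx M -> polynomial_map M.
Proof.
move=> MP l; apply: (@polynomial_function_ext (fun e =>
  l (\sum_(ij : 'I_m * 'I_n) M e ij.1 ij.2 *: delta_mx ij.1 ij.2))).
  by move=> e; rewrite [in RHS](matrix_sum_delta (M e)) pair_bigA.
exact: polynomial_map_sum.
Qed.

Lemma polynomial_map_pair (E1 E2 : vectType F) (f1 : E -> E1) (f2 : E -> E2) :
  polynomial_map f1 -> polynomial_map f2 ->
  polynomial_map (fun e => (f1 e, f2 e) : (E1 * E2)%type).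
Proof.
move=> f1P f2P l; pose b1 := vbasis {:E1}; pose b2 := vbasis {:E2}.
apply: (@polynomial_function_ext (fun e =>
  l (\sum_i coord b1 i (f1 e) *: (b1`_i, 0 : E2)) +
  l (\sum_i coord b2 i (f2 e) *: (0 : E1, b2`_i)))).
  move=> e; rewrite -linearD; congr (l _).
  rewrite [f1 e in RHS](coord_vbasis (memvf _)).
  rewrite [f2 e in RHS](coord_vbasis (memvf _)).
  rewrite [LHS]surjective_pairing /= !raddf_sum /=.
  congr (_, _).
    by rewrite [X in _ + X]big1 ?addr0 // => i _; rewrite scaler0.
  by rewrite [X in X + _]big1 ?add0r // => i _; rewrite scaler0.
by apply: polynomial_functionD; apply: polynomial_map_sum => i.
Qed.

Lemma polynomial_function_scalar f : scalar f -> polynomial_function f.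
Proof.
move=> fl; pose L : {linear E -> F | *%R} :=
  HB.pack f (GRing.isLinear.Build F E F *%R f fl).
exact: (polynomial_function_linear L).
Qed.

End PolynomialFunctions.

Lemma polynomial_mxvec (F : fieldType) (E : vectType F) m n
    (M : E -> 'M[F]_(m, n)) :
  polynomial_mx M -> polynomial_mx (fun e => mxvec (M e)).
Proof.
move=> MP i j; case/mxvec_indexP: j => a b; rewrite !ord1.
apply: (@polynomial_function_ext _ _ (fun e => M e a b)) => // e.
by rewrite mxvecE.
Qed.

Lemma polynomial_vec_mx (F : fieldType) (E : vectType F) m n
    (s : E -> 'rV[F]_(m * n)) :
  polynomial_mx s -> polynomial_mx (fun e => vec_mx (s e)).
Proof.
move=> sP i j.
apply: (@polynomial_function_ext _ _
  (fun e => s e 0 (mxvec_index i j))) => // e.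
by rewrite mxE.
Qed.

Lemma polynomial_lin_mulmx (F : fieldType) (E : vectType F) m n p
    (M : E -> 'M[F]_(m, n)) :
  polynomial_mx M ->
  polynomial_mx (fun e => lin_mulmx (M e) : 'M_(n * p, m * p)).
Proof.
move=> MP i j; apply: (@polynomial_function_ext _ _
  (fun e => mxvec (M e *m vec_mx (delta_mx 0 i)) 0 j)).
  by move=> e; rewrite mxE /=.
apply: polynomial_mxvec; apply: polynomial_mxM => //.
exact: polynomial_mx_cst.
Qed.

(** * Local lifts to homogeneous coordinates *)

(** Regular functions and open sets are described through coordinates, so a map
    is a morphism once it lifts, locally, to a polynomial map of coordinates. *)
Lemma coordinate_space_morphism (F : fieldType) (E E' : vectType F)
    (Z Z' : Type) (rep : E -> Z -> Prop) (rep' : E' -> Z' -> Prop)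
    (f : Z -> Z') :
  (forall e z, rep e z -> exists (b : E -> F) (phi : E -> E'),
     [/\ polynomial_function b, polynomial_map phi, b e != 0 &
       forall e1 z1, rep e1 z1 -> b e1 != 0 -> rep' (phi e1) (f z1)]) ->
  @fs_morphism F (coordinate_space rep) (coordinate_space rep') f.
Proof.
move=> lift; split=> [U oU e z ez Uz | U h oU hP e z ez Uz].
  have [b [phi [bP phiP be liftP]]] := lift e z ez.
  have [b' [b'P b'e UP]] := oU _ _ (liftP _ _ ez be) Uz.
  exists (fun e => b e * b' (phi e)); split.
  - exact/polynomial_functionM/polynomial_function_comp.
  - exact: mulf_neq0.
  move=> e1 z1 ez1; rewrite mulf_eq0 negb_or => /andP[be1 b'e1].
  exact: UP (liftP _ _ ez1 be1) b'e1.
have [b [phi [bP phiP be liftP]]] := lift e z ez.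
have [a' [b' [a'P b'P b'e hE]]] := hP _ _ (liftP _ _ ez be) Uz.
exists (fun e => b e * a' (phi e)), (fun e => b e * b' (phi e)); split.
- exact/polynomial_functionM/polynomial_function_comp.
- exact/polynomial_functionM/polynomial_function_comp.
- exact: mulf_neq0.
move=> e1 z1 ez1 Uz1; rewrite mulf_eq0 negb_or => /andP[be1 b'e1].
by rewrite -mulf_div divff // mul1r; apply: hE => //; apply: liftP.
Qed.

(** With L a generalized inverse of S, the rows of 1 - S L lie in the left
    kernel of S, hence are multiples of u. *)
Lemma rank_one_correction (F : fieldType) (p q : nat) (S : 'M[F]_(p, q))
    (u : 'rV[F]_p) :
  (forall w : 'rV_p, w *m S = 0 -> exists c, w = c *: u) ->
  exists (L : 'M[F]_(q, p)) (r : 'cV[F]_p), S *m L + r *m u = 1%:M.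
Proof.
move=> kerS; exists (pinvmx S).
have /submxP[r rE] : (1%:M - S *m pinvmx S <= u)%MS.
  apply/row_subP => i; apply/sub_rVP/kerS.
  by rewrite -row_mul mulmxBl mul1mx mulmxKpV // subrr row0.
by exists r; rewrite -rE addrC subrK.
Qed.

(** Cramer's rule for a kernel which is a line.  If S(e0) L + r u0 = 1, then
    M(e) = S(e) L + r u0 is invertible near e0; a solution w of w S(e) = 0
    satisfies w M(e) = (w r) u0, so it is proportional to u0 adj(M(e)). *)
Lemma polynomial_kernel_line (F : fieldType) (E : vectType F) (p q : nat)
    (S : E -> 'M[F]_(p, q)) (e0 : E) (u0 : 'rV[F]_p) :
  polynomial_mx S ->
  (forall w : 'rV_p, w *m S e0 = 0 -> exists c, w = c *: u0) ->
  exists (b : E -> F) (s : E -> 'rV[F]_p),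
    [/\ polynomial_function b, polynomial_mx s, b e0 != 0 &
      forall e, b e != 0 -> forall w : 'rV_p, w != 0 -> w *m S e = 0 ->
        exists2 c, c != 0 & s e = c *: w].
Proof.
move=> SP /rank_one_correction[L [r M1]].
pose M e := S e *m L + r *m u0.
have MP : polynomial_mx M.
  apply: polynomial_mxD; last exact: polynomial_mx_cst.
  by apply: polynomial_mxM => //; apply: polynomial_mx_cst.
exists (fun e => \det (M e)), (fun e => u0 *m \adj (M e)); split.
- exact: polynomial_det.
- by apply: polynomial_mxM; [apply: polynomial_mx_cst|apply: polynomial_adj].
- by rewrite /M M1 det1 oner_neq0.
move=> e dM w w0 wS.
have wM : (w *m r) 0 0 *: (u0 *m \adj (M e)) = \det (M e) *: w.
  rewrite -[RHS]mul_mx_scalar -mul_mx_adj mulmxA mulmxDr mulmxA wS mul0mx.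
  by rewrite add0r mulmxA [w *m r]mx11_scalar mul_scalar_mx -scalemxAl !mxE.
have c0 : (w *m r) 0 0 != 0.
  apply: contra_neq w0 => c0; move: wM; rewrite c0 scale0r => /esym/eqP.
  by rewrite scaler_eq0 (negPf dM) => /eqP.
exists (((w *m r) 0 0)^-1 * \det (M e)); first by rewrite mulf_neq0 ?invr_eq0.
by rewrite -scalerA -wM scalerA mulVf // scale1r.
Qed.

(** * Linear algebra *)

Section LinearAlgebra.
Variable F : fieldType.

Lemma dim_addv_line (vT : vectType F) (U : {vspace vT}) w :
  w \notin U -> \dim (U + <[w]>) = (\dim U).+1.
Proof.
move=> Uw; have w0 : w != 0 by apply: contraNneq Uw => ->; rewrite rpred0.
rewrite dimv_disjoint_sum ?dim_vline ?w0 ?addn1 //; apply/eqP.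
rewrite -subv0; apply/subvP => u; rewrite memv_cap memv0.
case/andP=> Uu /vlineP[c uE].
move: Uu; rewrite uE; have [->|c0] := eqVneq c 0; first by rewrite scale0r.
by rewrite rpredZeq (negPf c0) (negPf Uw).
Qed.

(** Passing from U to its part mapped into W loses at most the codimension of W
    in a space V that contains f(U). *)
Lemma dim_lpreim_cap (aT rT : vectType F) (f : 'Hom(aT, rT)) U W V :
  (f @: U <= V)%VS -> (W <= V)%VS ->
  (\dim U + \dim W <= \dim (U :&: f @^-1: W) + \dim V)%N.
Proof.
move=> fU WV; set U' := (U :&: _)%VS.
have fU' : (f @: U' = f @: U :&: W)%VS.
  apply/eqP; rewrite eqEsubv; apply/andP; split.
    rewrite subv_cap limgS ?capvSl //=; apply/subvP => _ /memv_imgP[u U'u ->].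
    by move: U'u; rewrite memv_cap -memv_preim => /andP[].
  apply/subvP => w; rewrite memv_cap => /andP[/memv_imgP[u Uu ->]] Wu.
  by rewrite memv_img // memv_cap Uu -memv_preim.
have kU' : (U' :&: lker f = U :&: lker f)%VS.
  apply/vspaceP => u; rewrite !memv_cap memv_ker -memv_preim.
  by case: eqP => [->|]; rewrite ?rpred0 ?andbT ?andbF.
have := limg_ker_dim f U'; have := limg_ker_dim f U; rewrite kU' fU'.
have := dimv_sum_cap (f @: U) W.
have : (\dim (f @: U + W) <= \dim V)%N by rewrite dimvS // subv_add fU.
by move=> h1 h2 <- <-; rewrite -!addnA leq_add2l -h2 addnC leq_add2l.
Qed.

Lemma mximg_line m n (A : 'M[F]_(m, n)) v : mximg A <[v]> = <[A *m v]>%VS.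
Proof. by rewrite /mximg limg_line lfunE. Qed.

Lemma memv_mximg m n (A : 'M[F]_(m, n)) (U : {vspace 'cV[F]_n}) :
  forall u : 'cV_n, u \in U -> A *m u \in mximg A U.
Proof. by move=> u Uu; rewrite -[A *m u](lfunE (mulmx A)); apply: memv_img. Qed.

Lemma mem_colspan m n (A : 'M[F]_(m, n)) (u : 'cV_m) :
  reflect (exists c, u = A *m c) (u \in colspan A).
Proof.
apply: (iffP memv_imgP) => [[c _ ->]|[c ->]]; exists c;
  by rewrite ?lfunE ?memvf.
Qed.

Lemma colspan_inj p k (C : 'M[F]_(p, k)) n : \dim (colspan C) = k ->
  injective (fun X : 'M_(k, n) => C *m X).
Proof.
move=> dC; have inj1 : injective (mulmx C : 'cV_k -> 'cV_p).
  have /lker0P Ci : lker (linfun (mulmx C : 'cV_k -> 'cV_p)) == 0%VS.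
    have := limg_ker_dim (linfun (mulmx C : 'cV_k -> 'cV_p)) fullv.
    rewrite capfv -/(colspan C) dC dimvf -dimv_eq0 (muln1 k : dim 'cV[F]_k = k).
    by lia.
  by move=> u v Cuv; apply: Ci; rewrite !lfunE.
move=> X Y CXY; apply/matrixP => i j.
suff /matrixP/(_ i 0) : col j X = col j Y by rewrite !mxE.
by apply: inj1; rewrite /= !colE !mulmxA CXY.
Qed.

Lemma colspan_factor p k n (A : 'M[F]_(p, n)) (C : 'M[F]_(p, k)) :
  (colspan A <= colspan C)%VS -> exists X, A = C *m X.
Proof.
move=> /subvP AC; suff /submxP[X /(congr1 trmx)] : (A^T <= C^T)%MS.
  by rewrite trmx_mul !trmxK => ->; exists X^T.
apply/row_subP => i; rewrite -tr_col.
have /AC/mem_colspan[c cE] : col i A \in colspan A.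
  by apply/mem_colspan; exists (delta_mx i 0); rewrite colE.
by rewrite cE trmx_mul submxMl.
Qed.

End LinearAlgebra.

(** * Invariant isotropic subspaces *)

Section RegularSemisimple.
Variables (F : numClosedFieldType) (N : nat) (B : {symmetric 'cV[F]_N}).
Hypothesis ndB : nondegenerate B.
Implicit Types (x : 'M[F]_N) (u v w : 'cV[F]_N) (U V W : {vspace 'cV[F]_N}).

Lemma nondegenerate_eq0 u : (forall w, B u w = 0) -> u = 0.
Proof.
move=> Bu0; apply/eqP; rewrite -memv0 -(eqP ndB).
by apply/mem_orthovP => w _; apply: Bu0.
Qed.

(** An element with N distinct eigenvalues has them all on the diagonal of any
    diagonal form, which therefore has no repeated entry. *)
Lemma g1rs_eigencoordinates x : g1rs B x ->
  exists P : 'M[F]_N, exists d : 'I_N -> F,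
    [/\ P \in unitmx, injective d &
        forall u i, (P *m (x *m u)) i 0 = d i * (P *m u) i 0].
Proof.
move=> [_ [P Pu /diagonalizable_forPex[D /(simmxP Pu) PxD]] [s [us ss es]]].
exists P; exists (fun i => D 0 i); split=> //; last first.
  by move=> u i; rewrite mulmxA PxD -mulmxA mul_diag_mx mxE.
apply/injectiveP; rewrite /injectiveb /dinjectiveb.
apply: (leq_size_uniq us); last by rewrite size_map -cardE card_ord ss.
move=> a /(allP es) /eigenvalueP[v vx v0].
have wD : (v *m invmx P) *m diag_mx D = a *: (v *m invmx P).
  have -> : diag_mx D = P *m x *m invmx P by rewrite PxD mulmxK.
  by rewrite !mulmxA mulmxKV // vx -scalemxAl.
have /rV0Pn[j wj0] : v *m invmx P != 0.
  by apply: contra_neq v0 => w0; rewrite -[v](mulmxKV Pu) w0 mul0mx.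
apply/mapP; exists j; first by rewrite mem_enum.
move: wj0; have /matrixP/(_ 0 j) := wD; rewrite mul_mx_diag mxE [RHS]mxE.
move: (_ 0 j) => c /eqP + c0.
by rewrite mulrC -subr_eq0 -mulrBl mulf_eq0 (negPf c0) orbF subr_eq0 => /eqP.
Qed.

(** Applying the product of the x - d_i over all i <> j to a vector of U whose
    j-th eigencoordinate is nonzero leaves a multiple of the j-th eigenvector.
    Eigenvectors for distinct eigenvalues are orthogonal, so if this one were
    isotropic it would be orthogonal to everything. *)
Lemma invariant_isotropic_eq0 x U : g1rs B x -> isotropic B U ->
  (forall u, u \in U -> x *m u \in U) -> U = 0%VS.
Proof.
move=> rx /orthovP isoU xU; have [[_ selfx] _ _] := rx.
have [P [d [Pu dinj Px]]] := g1rs_eigencoordinates rx.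
(* Applying the x - d_i for i in s only scales the eigencoordinates. *)
have filt (s : seq 'I_N) u : u \in U -> exists2 u', u' \in U &
    forall j, (P *m u') j 0 = (\prod_(i <- s) (d j - d i)) * (P *m u) j 0.
  move=> Uu; elim: s => [|i s [u1 Uu1 u1E]].
    by exists u => // j; rewrite big_nil mul1r.
  exists (x *m u1 - d i *: u1); first by rewrite rpredB ?rpredZ ?xU.
  move=> j; rewrite big_cons mulmxBr -scalemxAr.
  have -> (a b : 'cV[F]_N) c : (a - c *: b) j 0 = a j 0 - c * b j 0.
    by rewrite !mxE.
  by rewrite Px -mulrBl u1E mulrA.
apply/eqP; rewrite -subv0; apply/subvP => u Uu; rewrite memv0.
apply: contraT => u0.
have /cV0Pn[j Puj0] : P *m u != 0.
  by apply: contra_neq u0 => Pu0; rewrite -[u](mulKmx Pu) Pu0 mulmx0.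
have [u' Uu' u'E] := filt [seq i <- enum 'I_N | i != j] u Uu.
have u'j : (P *m u') j 0 != 0.
  rewrite u'E mulf_neq0 // prodf_seq_neq0; apply/allP => i.
  rewrite mem_filter subr_eq0 => /andP[ij _].
  by rewrite /= eq_sym (inj_eq dinj).
have u'i i : i != j -> (P *m u') i 0 = 0.
  move=> ij; rewrite u'E (bigD1_seq i) /=.
  - by rewrite subrr !mul0r.
  - by rewrite mem_filter ij mem_enum.
  - by rewrite filter_uniq // enum_uniq.
pose f i : 'cV_N := invmx P *m delta_mx i 0.
have wE w : w = \sum_i (P *m w) i 0 *: f i.
  rewrite -[LHS](mulKmx Pu) [P *m w in LHS]matrix_sum_delta mulmx_sumr.
  by apply: eq_bigr => l _; rewrite big_ord1 -scalemxAr.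
have xf i : x *m f i = d i *: f i.
  apply: (can_inj (mulKmx Pu)); apply/matrixP => l c; rewrite !ord1.
  rewrite Px -scalemxAr /f !mulKVmx // !mxE eqxx andbT.
  by case: eqP => [->|_]; rewrite ?mulr0.
have fij i l : i != l -> B (f i) (f l) = 0.
  move=> il; have := selfx (f i) (f l); rewrite !xf linearZl_LR linearZr_LR /=.
  move/eqP; rewrite -subr_eq0 -mulrBl mulf_eq0 subr_eq0 (inj_eq dinj).
  by rewrite (negPf il) => /eqP.
have u'f : u' = (P *m u') j 0 *: f j.
  by rewrite [LHS]wE (bigD1 j) //= big1 ?addr0 // => i /u'i->; rewrite scale0r.
have fjj : B (f j) (f j) = 0.
  have := isoU _ _ Uu' Uu'; rewrite u'f linearZl_LR linearZr_LR /=.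
  by move/eqP; rewrite !mulf_eq0 (negPf u'j) => /eqP.
suff u'0 : u' = 0 by rewrite u'0 mulmx0 mxE eqxx in u'j.
apply: nondegenerate_eq0 => w; rewrite u'f [w]wE linearZl_LR linear_sumr /=.
rewrite big1 ?mulr0 // => i _; rewrite linearZr_LR /=.
have [<-|/fij->] := eqVneq j i; last by rewrite mulr0.
by rewrite fjj mulr0.
Qed.

(** * Krylov subspaces *)

Definition krylov_space x k L : {vspace 'cV[F]_N} :=
  (\sum_(i < k) mximg (x ^+ i) L)%VS.

Definition krylov_mx x k v : 'M[F]_(N, k) := \matrix_(i, j) (x ^+ j *m v) i 0.

(** Applied to the larger space of an isotropic Krylov flag, it gives back the
    line from which the flag was built. *)
Definition krylov_core x k V : {vspace 'cV[F]_N} :=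
  (\bigcap_(i < k) (linfun (mulmx (x ^+ i) : 'cV_N -> 'cV_N) @^-1: V))%VS.

Lemma mulmx_exprS x i v : x ^+ i.+1 *m v = x *m (x ^+ i *m v).
Proof. by rewrite exprS -mulmxE mulmxA. Qed.

Lemma mulmx_exprD x i j v : x ^+ (i + j) *m v = x ^+ i *m (x ^+ j *m v).
Proof. by rewrite exprD -mulmxE mulmxA. Qed.

Lemma mem_krylov_core x k V u :
  reflect (forall i, (i < k)%N -> x ^+ i *m u \in V) (u \in krylov_core x k V).
Proof.
rewrite memvE; apply: (iffP subv_bigcapP) => [H i ik | H i _].
  by have := H (Ordinal ik) isT; rewrite -memvE -memv_preim lfunE.
by rewrite -memvE -memv_preim lfunE H.
Qed.

Lemma krylov_sub x j k L : (j <= k)%N ->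
  (krylov_space x j L <= krylov_space x k L)%VS.
Proof.
move=> jk; apply/subv_sumP => i _.
by apply: (sumv_sup (widen_ord jk i)).
Qed.

Lemma krylovS x k v :
  krylov_space x k.+1 <[v]> = (krylov_space x k <[v]> + <[x ^+ k *m v]>)%VS.
Proof. by rewrite /krylov_space big_ord_recr mximg_line. Qed.

Lemma krylov0 x L : krylov_space x 0 L = 0%VS.
Proof. by rewrite /krylov_space big_ord0. Qed.

Lemma krylov1 x v : krylov_space x 1 <[v]> = <[v]>%VS.
Proof. by rewrite krylovS krylov0 add0v mul1mx. Qed.

Lemma mem_krylov_pow x k v i : (i < k)%N ->
  x ^+ i *m v \in krylov_space x k <[v]>.
Proof.
move=> ik; apply: (subvP (krylov_sub _ _ ik)).
by rewrite krylovS (subvP (addvSr _ _)) ?memv_line.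
Qed.

Lemma krylov_subP x k v U :
  (forall i, (i < k)%N -> x ^+ i *m v \in U) ->
  (krylov_space x k <[v]> <= U)%VS.
Proof.
by move=> H; apply/subv_sumP => i _; rewrite mximg_line -memvE H.
Qed.

Lemma krylov_mulmx x k v u : u \in krylov_space x k <[v]> ->
  x *m u \in krylov_space x k.+1 <[v]>.
Proof.
move=> Ku; rewrite -[x *m u](lfunE (mulmx x)) memv_preim.
move: u Ku; apply/subvP/krylov_subP => i ik.
by rewrite -memv_preim lfunE /= -mulmx_exprS mem_krylov_pow.
Qed.

Lemma krylov_mulmx_pow x k v j u : u \in krylov_space x k <[v]> ->
  x ^+ j *m u \in krylov_space x (j + k) <[v]>.
Proof.
elim: j => [|j IH] Ku; first by rewrite mul1mx.
by rewrite mulmx_exprS addSn krylov_mulmx ?IH.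
Qed.

Lemma krylov_mxM x k v (c : 'cV_k) :
  krylov_mx x k v *m c = \sum_i c i 0 *: (x ^+ i *m v).
Proof.
apply/matrixP => a b; rewrite ord1 mxE summxE; apply: eq_bigr => i _.
by rewrite [RHS]mxE mulrC /krylov_mx [in LHS]mxE.
Qed.

Lemma colspan_krylov x k v : colspan (krylov_mx x k v) = krylov_space x k <[v]>.
Proof.
apply/eqP; rewrite eqEsubv; apply/andP; split.
  apply/subvP => _ /mem_colspan[c ->]; rewrite krylov_mxM.
  by apply: memv_suml => i _; rewrite rpredZ // mem_krylov_pow.
apply: krylov_subP => i ik; apply/mem_colspan.
exists (delta_mx (Ordinal ik) 0); rewrite krylov_mxM (bigD1 (Ordinal ik)) //=.
rewrite mxE !eqxx scale1r big1 ?addr0 // => j ji.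
by rewrite mxE (negPf ji) scale0r.
Qed.

Lemma form_expr x i j u v : g1 B x ->
  B (x ^+ i *m u) (x ^+ j *m v) = B (x ^+ (j + i) *m u) v.
Proof.
move=> [_ selfx]; elim: j i => [|j IH] i; first by rewrite mul1mx.
by rewrite mulmx_exprS -selfx -mulmx_exprS IH addnS.
Qed.

Lemma isotropic_sub U V : isotropic B V -> (U <= V)%VS -> isotropic B U.
Proof.
move=> /orthovP iV /subvP UV; apply/orthovP => u v Uu Uv.
by apply: iV; apply: UV.
Qed.

Lemma krylov_isotropic x k v : g1 B x ->
  (forall i, (i < 2 * k - 1)%N -> B (x ^+ i *m v) v = 0) ->
  isotropic B (krylov_space x k <[v]>).
Proof.
move=> gx qv; apply: krylov_subP => i ik; rewrite mem_orthov_sym.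
apply: krylov_subP => j jk; rewrite mem_orthov1 form_expr // qv //.
by rewrite ltn_subRL mul2n -addnn add1n -addSn -addnS leq_add.
Qed.

Section IsotropicKrylov.
Variables (x : 'M[F]_N) (k : nat) (v : 'cV[F]_N).
Hypotheses (rx : g1rs B x) (v0 : v != 0).
Hypothesis isoK : isotropic B (krylov_space x k <[v]>).

(** Otherwise the j-th Krylov space would be invariant and isotropic, hence
    zero. *)
Lemma krylov_notin j : (j <= k)%N -> x ^+ j *m v \notin krylov_space x j <[v]>.
Proof.
move=> jk; apply/negP => Kj.
have K0 : krylov_space x j <[v]> = 0%VS.
  apply: (invariant_isotropic_eq0 rx).
    exact/(isotropic_sub isoK)/krylov_sub.
  move=> u /krylov_mulmx; rewrite krylovS; apply/subvP.
  by rewrite subv_add subvv -memvE.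
case: j jk Kj K0 => [|j] jk Kj K0.
  by move: Kj; rewrite K0 memv0 mul1mx (negPf v0).
have := mem_krylov_pow x v (ltn0Sn j).
by rewrite K0 memv0 mul1mx (negPf v0).
Qed.

Lemma dim_krylov j : (j <= k)%N -> \dim (krylov_space x j <[v]>) = j.
Proof.
elim: j => [|j IH] jk; first by rewrite krylov0 dimv0.
by rewrite krylovS dim_addv_line ?krylov_notin ?IH // ltnW.
Qed.

(** If w has a component along x^j v with 0 < j < k and none along higher
    powers, then x^{k-j} w has one along x^k v, which leaves the k-th space. *)
Lemma krylov_coreK : (0 < k)%N ->
  krylov_core x k (krylov_space x k <[v]>) = <[v]>%VS.
Proof.
move=> k0; apply/eqP; rewrite eqEsubv; apply/andP; split; last first.
  by rewrite -memvE; apply/mem_krylov_core => i; apply: mem_krylov_pow.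
apply/subvP => w /mem_krylov_core Kw.
suff Kj j : (j < k)%N -> w \in krylov_space x (k - j) <[v]>.
  by have := Kj k.-1; rewrite -subn1 subKn // krylov1 subn1 ltn_predL; apply.
elim: j => [|j IH] jk; first by rewrite subn0; have := Kw _ k0; rewrite mul1mx.
have := IH (ltnW jk); rewrite -subnSK; last exact: ltnW.
rewrite krylovS => /memv_addP[w' Kw' [_ /vlineP[c ->] wE]].
suff c0 : c = 0 by rewrite wE c0 scale0r addr0.
have := Kw _ jk; rewrite wE mulmxDr -scalemxAr -mulmx_exprD.
have := krylov_mulmx_pow j.+1 Kw'; rewrite subnKC; last exact: ltnW.
move=> Kw'' /(rpredB)-/(_ _ Kw''); rewrite addrC addKr rpredZeq.
by rewrite (negPf (krylov_notin (leqnn k))) orbF => /eqP.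
Qed.

End IsotropicKrylov.

(** The pair formed by V' and the part of V' mapped into V' satisfies the same
    hypotheses with k replaced by k - 1, and a generator for it also serves for
    (V', V), as the one additional power of x sends it into x V'.  The
    hypotheses on dimensions are inequalities because V' may lose less than one
    dimension in this step. *)
Lemma ex_krylov_generator x k V' V : (0 < k)%N -> (k <= \dim V)%N ->
  (\dim V <= (\dim V').+1)%N -> (V' <= V)%VS -> (mximg x V' <= V)%VS ->
  exists2 v, v != 0 & (forall i, (i < k)%N -> x ^+ i *m v \in V) /\
                      (forall i, (i < k.-1)%N -> x ^+ i *m v \in V').
Proof.
case: k => // k _.
elim: k V' V => [|k IH] V' V dV dV' sV xV.
  exists (vpick V); first by rewrite vpick0 -dimv_eq0 -lt0n.
  by split=> // -[|//] _; rewrite mul1mx memv_pick.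
pose f : 'End('cV_N) := linfun (mulmx x).
have d2 := dim_lpreim_cap xV sV.
have [||||v v0 [vV _]] := IH (V' :&: f @^-1: V')%VS V'.
- exact: (leq_trans dV dV').
- by rewrite -(leq_add2r (\dim V')) (leq_trans d2) // addSnnS leq_add2l.
- exact: capvSl.
- apply/subvP => _ /memv_imgP[u + ->].
  by rewrite memv_cap -memv_preim => /andP[].
exists v => //; split=> // -[|i] ik.
  by rewrite (subvP sV) // vV.
by rewrite mulmx_exprS (subvP xV) // memv_mximg // vV.
Qed.

(** The Krylov spaces of the generator are contained in those of the flag, and
    they have the same dimensions because they are isotropic. *)
Lemma HessO_generator x k V' V :
  (0 < k)%N -> over_rs B (HessO B k) (x, V', V) ->
  exists2 v, v != 0 &
    [/\ V' = krylov_space x k.-1 <[v]>, V = krylov_space x k <[v]> &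
        isotropic B (krylov_space x k <[v]>)]%VS.
Proof.
move=> k0 [[gx [_ iV] [dV' dV] sV xV] rx].
have [||v v0 [vV vV']] := ex_krylov_generator k0 _ _ sV xV; rewrite ?dV ?dV' //.
  by rewrite prednK.
exists v => //; have KV := krylov_subP vV; have KV' := krylov_subP vV'.
have iK := isotropic_sub iV KV; split=> //; apply/esym/eqP; rewrite eqEdim.
  by rewrite KV' dV' (dim_krylov rx v0 iK) //= leq_pred.
by rewrite KV dV (dim_krylov rx v0 iK) /=.
Qed.

(** * Hessenberg flags and points of the quadrics *)

Definition flag_to_line k
    (h : 'M[F]_N * {vspace 'cV[F]_N} * {vspace 'cV[F]_N}) :=
  (h.1.1, krylov_core h.1.1 k h.2).

Definition line_to_flag k (p : 'M[F]_N * {vspace 'cV[F]_N}) :=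
  (p.1, krylov_space p.1 k.-1 p.2, krylov_space p.1 k p.2).

Lemma dim1_line U : \dim U = 1%N -> exists2 v, v != 0 & U = <[v]>%VS.
Proof.
move=> dU; have v0 : vpick U != 0 by rewrite vpick0 -dimv_eq0 dU.
exists (vpick U) => //; apply/esym/eqP.
by rewrite eqEdim -memvE memv_pick dU dim_vline v0.
Qed.

Lemma quadrics_line m k p : (2 * k - 1 <= m)%N -> quadrics B m p ->
  exists2 v, v != 0 & p.2 = <[v]>%VS /\ isotropic B (krylov_space p.1 k <[v]>).
Proof.
move=> km [[gx _ _] /dim1_line[v v0 pE] qp]; exists v => //; split=> //.
apply: krylov_isotropic => // i ik.
by have := qp v _ (Ordinal (leq_trans ik km)); rewrite pE memv_line; apply.
Qed.

Lemma flag_to_lineK k h : (0 < k)%N -> over_rs B (HessO B k) h ->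
  line_to_flag k (flag_to_line k h) = h.
Proof.
case: h => [[x V'] V] k0 Hh; have [_ rx] := Hh.
have [v v0 [-> -> iK]] := HessO_generator k0 Hh.
by rewrite /flag_to_line /line_to_flag /= (krylov_coreK rx v0).
Qed.

Lemma line_to_flagK m k p : (0 < k)%N -> (2 * k - 1 <= m)%N ->
  quadrics B m p -> flag_to_line k (line_to_flag k p) = p.
Proof.
move=> k0 km qp; have [rx _ _] := qp.
have [v v0 [pE iK]] := quadrics_line km qp.
case: p {qp} rx pE iK => x L /= rx -> iK.
by rewrite /flag_to_line /= (krylov_coreK rx v0).
Qed.

Lemma line_to_flag_HessO m k p : (0 < k)%N -> (2 * k - 1 <= m)%N ->
  quadrics B m p -> over_rs B (HessO B k) (line_to_flag k p).
Proof.
move=> k0 km qp; have [rx _ _] := qp.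
have [v v0 [pE iK]] := quadrics_line km qp.
case: p {qp} rx pE iK => x L /= rx -> iK; split=> //; have [gx _ _] := rx.
split=> //.
- by split=> //; apply: (isotropic_sub iK); apply: krylov_sub; apply: leq_pred.
- by rewrite !(dim_krylov rx v0 iK) // leq_pred.
- by apply: krylov_sub; apply: leq_pred.
apply/subvP => _ /mem_mximg[u Ku ->].
by have := krylov_mulmx Ku; rewrite prednK.
Qed.

Lemma line_to_flag_HessE k p : (0 < k)%N ->
  quadrics B (2 * k) p -> over_rs B (HessE B k) (line_to_flag k p).
Proof.
move=> k0 qp; have km := leq_subr 1 (2 * k); have [rx _ pq] := qp.
have [Op _] := line_to_flag_HessO k0 km qp.
split; last by [].
split=> //; have [v v0 [pE iK]] := quadrics_line km qp.
have {}pq i : (i < 2 * k)%N -> B (p.1 ^+ i *m v) v = 0.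
  by move=> ik; have := pq v _ (Ordinal ik); rewrite pE memv_line; apply.
have [gx _ _] := rx; rewrite /= pE; apply/subvP => _ /mem_mximg[u Ku ->].
move: u Ku; suff /subvP H: (krylov_space p.1 k <[v]> <=
    linfun (mulmx p.1 : 'cV_N -> 'cV_N) @^-1:
      orthov B (krylov_space p.1 k <[v]>))%VS.
  by move=> u /H; rewrite -memv_preim lfunE.
apply: krylov_subP => i ik; rewrite -memv_preim lfunE /= -mulmx_exprS.
rewrite mem_orthov_sym; apply: krylov_subP => j jk.
by rewrite mem_orthov1 form_expr // pq //; lia.
Qed.

(** Each exponent below 2k - 1 is a sum of two exponents below k, so the
    corresponding equation follows from the isotropy of V_k; the hypothesis on
    the remaining exponents is what distinguishes the two families. *)
Lemma flag_to_line_quadrics k h m : (0 < k)%N -> over_rs B (HessO B k) h ->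
  (forall v, (forall i, (i < k)%N -> h.1.1 ^+ i *m v \in h.2) ->
     forall i, (2 * k - 1 <= i < m)%N -> B (h.1.1 ^+ i *m v) v = 0) ->
  quadrics B m (flag_to_line k h).
Proof.
case: h => [[x V'] V] /= k0 Hh tl; have [[gx [_ iV] _ _ _] rx] := Hh.
split=> //=.
  have [v v0 [_ -> iK]] := HessO_generator k0 Hh.
  by rewrite (krylov_coreK rx v0 iK k0) dim_vline v0.
move=> v /mem_krylov_core Vv [i /= im].
have [ik|ik] := leqP (2 * k - 1) i; first by rewrite tl ?ik.
(* i is split as min(i, k - 1) plus the rest *)
rewrite -(subnK (geq_minl i k.-1)) addnC -form_expr //.
by have := orthovP iV; apply; apply: Vv; lia.
Qed.

Lemma flag_to_line_HessO k h : (0 < k)%N -> over_rs B (HessO B k) h ->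
  quadrics B (2 * k - 1) (flag_to_line k h).
Proof.
move=> k0 Hh; apply: flag_to_line_quadrics => // v _ i.
by case: ltngtP.
Qed.

(** The one remaining exponent is 2k - 1 = (k - 1) + k, and x^k v lies in
    x V_k, which is orthogonal to V_k. *)
Lemma flag_to_line_HessE k h : (0 < k)%N -> over_rs B (HessE B k) h ->
  quadrics B (2 * k) (flag_to_line k h).
Proof.
case: h => [[x V'] V] k0 [[Hh /orthovP oV] rx].
apply: flag_to_line_quadrics => //= v Vv i ik.
have [gx _ _] := rx.
have -> : i = (k.-1 + k.-1.+1)%N by lia.
by rewrite -form_expr // mulmx_exprS oV ?memv_mximg // Vv // ltn_predL.
Qed.

Lemma conj_act_expr g x i : SO B g -> conj_act g x ^+ i *m g = g *m x ^+ i.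
Proof.
move=> /SO_unit gu; elim: i => [|i IH]; first by rewrite !expr0 mul1mx mulmx1.
rewrite !exprS -!mulmxE -mulmxA IH /conj_act !mulmxA.
by rewrite mulmxKV.
Qed.

Lemma krylov_space_conj g x k L : SO B g ->
  krylov_space (conj_act g x) k (mximg g L) = mximg g (krylov_space x k L).
Proof.
move=> Kg; rewrite /krylov_space [RHS]limg_sum; apply: eq_bigr => i _.
by rewrite -!/(mximg _ _) -!mximgM conj_act_expr.
Qed.

Lemma line_to_flag_act k g p : SO B g ->
  line_to_flag k (line_act g p) = flag_act g (line_to_flag k p).
Proof.
by move=> Kg; rewrite /line_to_flag /line_act /flag_act /= !krylov_space_conj.
Qed.

(** * Recovering the line by a linear system *)

Lemma krylov_mxZ x k c v : krylov_mx x k (c *: v) = c *: krylov_mx x k v.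
Proof.
by apply/matrixP => i j; rewrite mxE -scalemxAr mxE [RHS]mxE [in RHS]mxE.
Qed.

Lemma col_krylov x k v j : col j (krylov_mx x k v) = x ^+ j *m v.
Proof. by apply/matrixP => a b; rewrite mxE mxE ord1. Qed.

Lemma col0_krylov x k v : col 0 (krylov_mx x k.+1 v) = v.
Proof. by rewrite col_krylov mul1mx. Qed.

Lemma krylov_mxP x k (Y : 'M_(N, k.+1)) :
  reflect (Y = krylov_mx x k.+1 (col 0 Y))
    (colsub (widen_ord (leqnSn k)) (x *m Y) == colsub (lift ord0) Y).
Proof.
have colM (M : 'M_(N, k.+1)) j : col j (x *m M) = x *m col j M.
  by rewrite !colE mulmxA.
apply: (iffP eqP) => [YE|->]; last first.
  apply/matrixP => i j; rewrite [RHS]mxE [RHS]mxE [LHS]mxE.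
  have := colM (krylov_mx x k.+1 (col 0 Y)) (widen_ord (leqnSn k) j).
  move=> /matrixP/(_ i 0); rewrite mxE => ->.
  by rewrite col_krylov -mulmx_exprS.
suff colY j (jk : (j < k.+1)%N) : col (Ordinal jk) Y = x ^+ j *m col 0 Y.
  apply/matrixP => i [j jk]; have /matrixP/(_ i 0) := colY j jk.
  by rewrite mxE => ->; rewrite [RHS]mxE.
elim: j jk => [|j IH] jk.
  by rewrite mul1mx; congr (col _ Y); apply: val_inj.
have jk' : (j < k)%N by [].
rewrite mulmx_exprS -(IH (ltnW jk)) -colM.
have /matrixP YE' := YE; apply/matrixP => i b.
have := YE' i (Ordinal jk'); rewrite mxE [in RHS]mxE.
have -> : widen_ord (leqnSn k) (Ordinal jk') = Ordinal (ltnW jk).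
  exact: val_inj.
have -> : lift ord0 (Ordinal jk') = Ordinal jk by apply: val_inj.
by move=> YE1; rewrite mxE [RHS]mxE.
Qed.

(** The matrix, acting on row vectors mxvec X, of the linear map sending X to
    the differences between x times the j-th column of C X and its next
    column. *)
Definition krylov_system k (x : 'M[F]_N) (C : 'M[F]_(N, k.+1)) :
    'M[F]_(k.+1 * k.+1, N * k) :=
  lin_mulmx (x *m C) *m lin_mulmxr (colsub (widen_ord (leqnSn k)) 1%:M) -
  lin_mulmx C *m lin_mulmxr (colsub (lift ord0) 1%:M).

Lemma krylov_systemP k x (C : 'M_(N, k.+1)) (X : 'M_k.+1) :
  reflect (C *m X = krylov_mx x k.+1 (col 0 (C *m X)))
    (mxvec X *m krylov_system x C == 0).
Proof.
rewrite /krylov_system mulmxBr !mulmxA !mul_vec_lin /= -!mulmxA.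
rewrite -linearB mxvec_eq0 subr_eq0 !mulmx_colsub !mulmx1 !mulmxA -mulmxA.
exact: krylov_mxP.
Qed.

(** If X is a solution, the columns of C X are the Krylov vectors of the first
    one, and they lie in the column space of C; so the first one is in the core,
    which is a line, and it determines C X, hence X. *)
Lemma krylov_system_kernel k x V' (C : 'M[F]_(N, k.+1)) :
  over_rs B (HessO B k.+1) (x, V', colspan C) ->
  exists v (X : 'M[F]_k.+1),
    [/\ v != 0, krylov_core x k.+1 (colspan C) = <[v]>%VS,
        C *m X = krylov_mx x k.+1 v &
        forall w : 'rV_(k.+1 * k.+1), w *m krylov_system x C = 0 ->
          exists c, w = c *: mxvec X].
Proof.
move=> Hh; have [[_ _ [_ dC] _ _] rx] := Hh.
have [v v0 [_ CE iK]] := HessO_generator (ltn0Sn k) Hh.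
have coreE : krylov_core x k.+1 (colspan C) = <[v]>%VS.
  by rewrite CE (krylov_coreK rx v0 iK).
have [|X XE] := @colspan_factor _ _ _ _ (krylov_mx x k.+1 v) C.
  by rewrite colspan_krylov CE.
exists v, X; split=> // w; rewrite -[w]vec_mxK; move: (vec_mx w) => {w} Y.
move=> /eqP/krylov_systemP YE.
have /vlineP[c cE] : col 0 (C *m Y) \in <[v]>%VS.
  rewrite -coreE; apply/mem_krylov_core => i ik.
  apply/mem_colspan; exists (col (Ordinal ik) Y).
  have -> : C *m col (Ordinal ik) Y = col (Ordinal ik) (C *m Y).
    by rewrite !colE mulmxA.
  by rewrite {2}YE col_krylov.
exists c; rewrite -linearZ; congr mxvec; apply: (colspan_inj dC) => /=.
by rewrite YE cE krylov_mxZ XE scalemxAr.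
Qed.

(** * The isomorphism of families *)

Lemma flag_to_line_morphism k m
    (Z : set ('M[F]_N * {vspace 'cV[F]_N} * {vspace 'cV[F]_N}))
    (f : Z -> quadrics B m) :
  (0 < k)%N -> (forall h, Z h -> over_rs B (HessO B k) h) ->
  (forall z, val (f z) = flag_to_line k (val z)) ->
  @fs_morphism F (flag_space k Z) (line_space (quadrics B m)) f.
Proof.
case: k => // k _ ZO fE; apply: coordinate_space_morphism => e0 z0 ez0.
have kerP (e : 'M[F]_N * 'M[F]_(N, k) * 'M[F]_(N, k.+1)) (z : Z) :
    val z = (e.1.1, colspan e.1.2, colspan e.2) ->
  exists v (X : 'M[F]_k.+1),
    [/\ v != 0, krylov_core e.1.1 k.+1 (colspan e.2) = <[v]>%VS,
        e.2 *m X = krylov_mx e.1.1 k.+1 v &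
        forall w : 'rV_(k.+1 * k.+1), w *m krylov_system e.1.1 e.2 = 0 ->
          exists c, w = c *: mxvec X].
  move=> ez; apply: (@krylov_system_kernel _ _ (colspan e.1.2)).
  by rewrite -ez; apply/ZO/set_valP.
pose E := ('M[F]_N * 'M[F]_(N, k) * 'M[F]_(N, k.+1))%type.
have xP : polynomial_mx (fun e : E => e.1.1).
  by move=> i j; apply: polynomial_function_scalar => a u v; rewrite /= !mxE.
have CP : polynomial_mx (fun e : E => e.2).
  by move=> i j; apply: polynomial_function_scalar => a u v; rewrite /= !mxE.
have SP : polynomial_mx (fun e : E => krylov_system e.1.1 e.2).
  apply: polynomial_mxD; last apply: polynomial_mxN.
    apply: polynomial_mxM; last exact: polynomial_mx_cst.
    by apply: polynomial_lin_mulmx; apply: polynomial_mxM.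
  apply: polynomial_mxM; last exact: polynomial_mx_cst.
  exact: polynomial_lin_mulmx.
have [v0 [X0 [_ _ _ /(polynomial_kernel_line SP)]]] := kerP e0 z0 ez0.
move=> [b [s [bP sP be0 sE]]].
exists b, (fun e : E => (e.1.1, col 0 (e.2 *m vec_mx (s e)))); split=> //.
  apply: polynomial_map_pair; first exact: polynomial_map_mx.
  apply: polynomial_map_mx => i j.
  apply: (@polynomial_function_ext _ _
    (fun e : E => (e.2 *m vec_mx (s e)) i 0)).
    by move=> e; rewrite [in RHS]mxE.
  by apply: polynomial_mxM => //; apply: polynomial_vec_mx.
move=> e z ez be; have [v [X [v_neq0 coreE XE _]]] := kerP e z ez.
have X0' : mxvec X != 0.
  apply: contra_neq v_neq0 => /eqP; rewrite mxvec_eq0 => /eqP X_eq0.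
  by rewrite -(col0_krylov e.1.1 k v) -XE X_eq0 mulmx0 col0.
have XS : mxvec X *m krylov_system e.1.1 e.2 = 0.
  by apply/eqP/krylov_systemP; rewrite XE col0_krylov.
have [c c0 ->] := sE e be _ X0' XS.
rewrite fE /flag_to_line ez /= coreE linearZ /= mxvecK -scalemxAr XE.
rewrite linearZ /= col0_krylov; congr (_, _); apply/eqP.
rewrite eq_sym eqEdim !dim_vline scaler_eq0 (negPf c0) leqnn andbT -memvE.
by rewrite memvZ ?memv_line.
Qed.

Lemma line_to_flag_morphism k m
    (Z : set ('M[F]_N * {vspace 'cV[F]_N} * {vspace 'cV[F]_N}))
    (f : quadrics B m -> Z) :
  (forall z, val (f z) = line_to_flag k (val z)) ->
  @fs_morphism F (line_space (quadrics B m)) (flag_space k Z) f.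
Proof.
move=> fE; apply: coordinate_space_morphism => e0 z0 _.
pose E := ('M[F]_N * 'cV[F]_N)%type.
exists (fun _ : E => 1), (fun e : E =>
  (e.1, krylov_mx e.1 k.-1 e.2, krylov_mx e.1 k e.2)).
have xP : polynomial_mx (fun e : E => e.1).
  by move=> i j; apply: polynomial_function_scalar => a u v; rewrite /= !mxE.
have vP : polynomial_mx (fun e : E => e.2).
  by move=> i j; apply: polynomial_function_scalar => a u v; rewrite /= !mxE.
have KP n : polynomial_mx (fun e : E => krylov_mx e.1 n e.2).
  move=> i j; apply: (@polynomial_function_ext _ _
    (fun e : E => (e.1 ^+ j *m e.2) i 0)); first by move=> e; rewrite [RHS]mxE.
  by apply: polynomial_mxM => //; apply: polynomial_mxX.
split; [exact: polynomial_function_cst| |exact: oner_neq0|].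
  do !apply: polynomial_map_pair; exact: polynomial_map_mx.
by move=> e z ez _; rewrite fE ez /line_to_flag /= !colspan_krylov.
Qed.

(** The two families differ only in the number m of quadrics and in the
    conditions on flags, which enter through the last two hypotheses. *)
Lemma flag_line_isomorphism k m
    (Z : set ('M[F]_N * {vspace 'cV[F]_N} * {vspace 'cV[F]_N}))
    (aZ : forall g h, SO B g -> Z h -> Z (flag_act g h)) :
  (0 < k)%N -> (2 * k - 1 <= m)%N ->
  (forall h, Z h -> over_rs B (HessO B k) h) ->
  (forall h, Z h -> quadrics B m (flag_to_line k h)) ->
  (forall p, quadrics B m p -> Z (line_to_flag k p)) ->
  exists phi : Z -> quadrics B m,
    equivariant_isomorphism_over_g1rs k (restricted_act aZ) phi.
Proof.
move=> k0 km ZO Zq qZ.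
pose f (z : Z) : quadrics B m := SigSub (mem_set (Zq _ (set_valP z))).
pose g (p : quadrics B m) : Z := SigSub (mem_set (qZ _ (set_valP p))).
have fK : cancel f g.
  by move=> z; apply: val_inj; apply: (flag_to_lineK k0 (ZO _ (set_valP z))).
have gK : cancel g f.
  by move=> p; apply: val_inj; apply: (line_to_flagK k0 km (set_valP p)).
exists f; split=> //.
  split; last by exists g => //; apply: line_to_flag_morphism.
  exact: flag_to_line_morphism.
(* The Krylov flag is a natural construction, so equivariance is checked on
   the inverse. *)
move=> a z; apply: (can_inj gK); rewrite fK; apply: val_inj => /=.
rewrite [RHS](line_to_flag_act _ _ (set_valP a)).
by congr flag_act; rewrite -[in LHS](fK z).
Qed.

End RegularSemisimple.

Theorem theorem2p5 (R : realType) (N : nat) (B : {symmetric 'cV[R[i]]_N})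
    (B_nondegenerate : nondegenerate B)
    (k : nat) (k_ge1 : (1 <= k)%N) (k_le : (2 * k <= N - 1)%N) :
  (exists phi : over_rs B (HessO B k) -> quadrics B (2 * k - 1),
     equivariant_isomorphism_over_g1rs k
       (restricted_act (@HessO_stable R[i] N B k)) phi) /\
  (exists phi : over_rs B (HessE B k) -> quadrics B (2 * k),
     equivariant_isomorphism_over_g1rs k
       (restricted_act (@HessE_stable R[i] N B k)) phi).
Proof.
split; apply: flag_line_isomorphism => //.
- by move=> h; apply: flag_to_line_HessO.
- by move=> p; apply: line_to_flag_HessO.
- exact: leq_subr.
- by move=> [[x V'] V] [[]].
- by move=> h; apply: flag_to_line_HessE.
- by move=> p; apply: line_to_flag_HessE.
Qed.
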